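(* Let $\mathcal{S}$ be the class of simple combinatorial auctions defined in the context. For every auction in $\mathcal{S}$ with $n$ players and $m$ items, the pure liquid price of anarchy of the auction, over games in which all players have (monotone) subadditive valuation functions, is at least $2-\frac{n-1}{m}-\frac{1}{n}$.
   Context: Setting: $m$ items are allocated to $n$ players. Player $i$ has a valuation function $v_i:2^{[m]}\to\mathbb{R}_{\ge 0}$ and a private budget $c_i\ge 0$ (private: the auction's rules do not depend on the valuations or the budgets). A valuation $v_i$ is monotone if $S\subseteq T$ implies $v_i(S)\le v_i(T)$, and subadditive if $v_i(S\cup T)\le v_i(S)+v_i(T)$ for all $S,T\subseteq[m]$. All valuations are assumed monotone and subadditive. Class $\mathcal{S}$: each player $i$ submits bids $\mathbf{b}_i=(b_{ij})_{j\in[m]}$, $b_{ij}\ge 0$; $\mathbf{b}=(\mathbf{b}_i)_{i\in[n]}$ and $\mathbf{b}_{[j]}=(b_{ij})_{i\in[n]}$. An auction in $\mathcal{S}$ allocates each item $j$ independently to a player $\pi(j)$ with the highest bid for it ($b_{\pi(j),j}\ge b_{ij}$ for all $i$; items for which several players have the highest bid are given arbitrarily to one of these players), and charges $\pi(j)$ a payment $p_j(\mathbf{b}_{[j]})\in[0,b_{\pi(j),j}]$, where $p_j$ is non-decreasing and continuous in every bid. $\mathbf{X}(\mathbf{b})=(X_1,\dots,X_n)$ denotes the resulting allocation, a partition of $[m]$. Utility: $u_i(\mathbf{b})=v_i(X_i)-\sum_{j\in X_i}p_j(\mathbf{b}_{[j]})$ if player $i$'s total payment does not exceed $c_i$, and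 $-\infty$ otherwise. A bid matrix $\mathbf{b}$ is a pure Nash equilibrium if $u_i(\mathbf{b})\ge u_i(\mathbf{y},\mathbf{b}_{-i})$ for every player $i$ and every bid vector $\mathbf{y}$, where $(\mathbf{y},\mathbf{b}_{-i})$ is $\mathbf{b}$ with $\mathbf{b}_i$ replaced by $\mathbf{y}$. $\mathrm{EQ}(\mathcal{G})$ is the set of equilibria of the game $\mathcal{G}$. Conservative behavior (standing assumption): the sum of bids a player submits for a bundle of items exceeds neither her value for this bundle nor her budget, that is, $\sum_{j\in X_i}b_{ij}\le\min\{v_i(X_i),c_i\}$. Liquid welfare: for an allocation $\mathbf{X}$ (a partition of $[m]$ among the players), $\mathrm{LW}(\mathbf{X})=\sum_{i\in[n]}\min\{v_i(X_i),c_i\}$. The pure liquid price of anarchy of an auction is $\mathrm{LPoA}=\sup_{\mathcal{G}}\frac{\max_{\mathbf{Y}}\mathrm{LW}(\mathbf{Y})}{\min_{\mathbf{b}\in\mathrm{EQ}(\mathcal{G})}\mathrm{LW}(\mathbf{X}(\mathbf{b}))}$, the supremum being over all games induced by the auction. *)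

(* Defs.v *)
From HB Require Import structures.
From mathcomp Require Import all_boot all_order all_algebra.
From mathcomp Require Import all_classical all_reals all_analysis.
Set Implicit Arguments.
Unset Strict Implicit.
Unset Printing Implicit Defensive.
Import Order.TTheory GRing.Theory Num.Theory.
Import numFieldNormedType.Exports.
Local Open Scope classical_set_scope.
Local Open Scope ring_scope.

(* Conventions: players are 'I_n, items are 'I_m, and a bid matrix is a
   function b with b i j the bid of player i for item j, so that b i is the
   bid vector of player i and b^~ j is the vector of all bids for item j.
   [eta b with i |-> y] is b with the entry (or row) at i replaced by y. *)

(* The rules for item j see only the bids for item j. [winner] includes a fixed
   but arbitrary tie-breaking rule. Bids being non-negative, the rules are
   constrained on non-negative bid vectors only; in particular, continuity is
   continuity on [0, +oo[ in each bid separately. *)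
Record simple_auction (R : realType) (n m : nat) := SimpleAuction {
  winner : 'I_m -> ('I_n -> R) -> 'I_n ;
  payment : 'I_m -> ('I_n -> R) -> R ;
  winner_max : forall (j : 'I_m) (b : 'I_n -> R), (forall k, 0 <= b k) ->
    forall i, b i <= b (winner j b) ;
  payment_ge0 : forall (j : 'I_m) (b : 'I_n -> R), (forall k, 0 <= b k) ->
    0 <= payment j b ;
  payment_le_bid : forall (j : 'I_m) (b : 'I_n -> R), (forall k, 0 <= b k) ->
    payment j b <= b (winner j b) ;
  payment_nondecreasing : forall (j : 'I_m) (b : 'I_n -> R) (i : 'I_n),
    (forall k, 0 <= b k) ->
    {in `[0, +oo[ &, {homo (fun t : R => payment j [eta b with i |-> t]) :
                        s t / s <= t}} ;
  payment_continuous : forall (j : 'I_m) (b : 'I_n -> R) (i : 'I_n),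
    (forall k, 0 <= b k) ->
    {within `[0, +oo[,
       continuous (fun t : R => payment j [eta b with i |-> t])}
}.

Definition monotone (R : realType) (m : nat) (v : {set 'I_m} -> R) :=
  forall S T : {set 'I_m}, S \subset T -> v S <= v T.

Definition subadditive (R : realType) (m : nat) (v : {set 'I_m} -> R) :=
  forall S T : {set 'I_m}, v (S :|: T)%SET <= v S + v T.

Record players (R : realType) (n m : nat) := Players {
  valuation : 'I_n -> {set 'I_m} -> R ;
  budget : 'I_n -> R ;
  valuation_ge0 : forall i S, 0 <= valuation i S ;
  valuation_monotone : forall i, monotone (valuation i) ;
  valuation_subadditive : forall i, subadditive (valuation i) ;
  budget_ge0 : forall i, 0 <= budget i
}.

(* An allocation, i.e. a partition of the items among the players (with
   possibly empty parts), is the map sending each item to its owner. *)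
Definition bundle (n m : nat) (Y : {ffun 'I_m -> 'I_n}) (i : 'I_n) :
    {set 'I_m} :=
  [set j | Y j == i]%SET.

Definition liquid_welfare (R : realType) (n m : nat) (G : players R n m)
    (Y : {ffun 'I_m -> 'I_n}) : R :=
  \sum_(i < n) Num.min (valuation G i (bundle Y i)) (budget G i).

(* The base value 0 is harmless, the liquid welfare being non-negative. *)
Definition optimal_liquid_welfare (R : realType) (n m : nat)
    (G : players R n m) : R :=
  \big[Num.max/0]_(Y : {ffun 'I_m -> 'I_n}) liquid_welfare G Y.

Definition outcome (R : realType) (n m : nat) (A : simple_auction R n m)
    (b : 'I_n -> 'I_m -> R) : {ffun 'I_m -> 'I_n} :=
  [ffun j => winner A j (b^~ j)].

Definition total_payment (R : realType) (n m : nat) (A : simple_auction R n m)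
    (b : 'I_n -> 'I_m -> R) (i : 'I_n) : R :=
  \sum_(j in bundle (outcome A b) i) payment A j (b^~ j).

Definition utility (R : realType) (n m : nat) (A : simple_auction R n m)
    (G : players R n m) (b : 'I_n -> 'I_m -> R) (i : 'I_n) : \bar R :=
  if total_payment A b i <= budget G i
  then (valuation G i (bundle (outcome A b) i) - total_payment A b i)%:E
  else -oo%E.

Definition conservative (R : realType) (n m : nat) (A : simple_auction R n m)
    (G : players R n m) (b : 'I_n -> 'I_m -> R) (i : 'I_n) :=
  \sum_(j in bundle (outcome A b) i) b i j <=
    Num.min (valuation G i (bundle (outcome A b) i)) (budget G i).

(* Conservative behaviour restricts the bids that players may submit, hence
   the deviations available to a player as well as the equilibrium bids. *)
Definition equilibrium (R : realType) (n m : nat) (A : simple_auction R n m)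
    (G : players R n m) (b : 'I_n -> 'I_m -> R) :=
  [/\ forall i j, 0 <= b i j,
      forall i, conservative A G b i
    & forall (i : 'I_n) (y : 'I_m -> R), (forall j, 0 <= y j) ->
        conservative A G [eta b with i |-> y] i ->
        (utility A G [eta b with i |-> y] i <= utility A G b i)%E].

Definition worst_equilibrium_liquid_welfare (R : realType) (n m : nat)
    (A : simple_auction R n m) (G : players R n m) : \bar R :=
  ereal_inf [set (liquid_welfare G (outcome A b))%:E
            | b in [set b | equilibrium A G b]].

(* The quotient is the one of \bar R: x / 0 = +oo for x > 0, and 0 / 0 = 0,
   so that a game of the latter kind does not affect the supremum. *)
Definition LPoA (R : realType) (n m : nat) (A : simple_auction R n m) :
    \bar R :=
  ereal_sup
    [set ((optimal_liquid_welfare G)%:E / worst_equilibrium_liquid_welfare A G)%E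
    | G in [set G : players R n m | exists b, equilibrium A G b]].

(* Main.v *)
(* If everybody bids 1 on every item, the tie-breaking rule fixes an
   allocation X, say with x_i items for player i. Let i0 receive the fewest
   items, x_i0 <= m / n. Player i0 values a bundle at its size and has budget m;
   any other player i has budget x_i, values x_i items or more at 2 x_i and
   fewer items, if any, at x_i. A new item can only be won by bidding more than
   1, so a conservative deviation that wins one must win fewer than x_i items
   (impossible for i0), and then half of the value is lost, which no saving on
   payments, at most x_i, makes up for. The tied bids are thus an equilibrium,
   of liquid welfare m. Giving instead one item to each i <> i0, which already
   exhausts her budget, and all the others to i0 yields (m - x_i0) + (m - n + 1).
   If m < n the bound is below 1; if n = 1 the equilibrium is to bid 0, a lone
   player having an interest in lowering a winning bid. *)

Require Import Defs.
From mathcomp Require Import all_boot all_order all_algebra.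
From mathcomp Require Import all_classical all_reals all_analysis.
From mathcomp Require Import zify ring lra.
Import Order.TTheory GRing.Theory Num.Theory.
Local Open Scope ring_scope.

Lemma sum_card_bundle (n m : nat) (Y : {ffun 'I_m -> 'I_n}) :
  (\sum_(i < n) #|bundle Y i|)%N = m.
Proof.
rewrite -[RHS]card_ord -sum1_card (partition_big Y xpredT) //=.
by apply: eq_bigr => i _; rewrite -sum1_card; apply: eq_bigl => j; rewrite inE.
Qed.

(** The boolean sum counts which of the sizes 1 and [x] are reached, so the values are 0, [x] and
    [2x], and all are 0 if [x = 0]. *)
Definition threshold_value (m x : nat) (S : {set 'I_m}) : nat :=
  (x * ((0 < #|S|) + (x <= #|S|)))%N.
Arguments threshold_value {m} x S.

Lemma threshold_value_monotone (m x : nat) (S T : {set 'I_m}) :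
  S \subset T -> (threshold_value x S <= threshold_value x T)%N.
Proof. by move=> /subset_leq_card ST; rewrite leq_mul2l; lia. Qed.

(** Two nonempty sets already contribute [2x], the largest possible value; if one is empty, the
    union has the size of the other. *)
Lemma threshold_value_subadditive (m x : nat) (S T : {set 'I_m}) :
  (threshold_value x (S :|: T)%SET <=
     threshold_value x S + threshold_value x T)%N.
Proof.
have := cardsUI S T; have := subset_leq_card (subsetIl S T).
have := subset_leq_card (subsetIr S T).
by rewrite /threshold_value -mulnDr leq_mul2l; lia.
Qed.

Section Game.
Variables (R : realType) (n m : nat) (x : 'I_n -> nat) (i0 : 'I_n).

Definition game_value (i : 'I_n) (S : {set 'I_m}) : R :=
  (if i == i0 then #|S| else threshold_value (x i) S)%:R.

Definition game_budget (i : 'I_n) : R := (if i == i0 then m else x i)%:R.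

Lemma game_value_ge0 i S : 0 <= game_value i S.
Proof. exact: ler0n. Qed.

Lemma game_value_monotone i : Defs.monotone (game_value i).
Proof.
move=> S T ST; rewrite ler_nat; case: ifP => _.
  exact: subset_leq_card.
exact: threshold_value_monotone.
Qed.

Lemma game_value_subadditive i : Defs.subadditive (game_value i).
Proof.
move=> S T; rewrite -natrD ler_nat; case: ifP => _.
  by rewrite cardsU leq_subr.
exact: threshold_value_subadditive.
Qed.

Lemma game_budget_ge0 i : 0 <= game_budget i.
Proof. exact: ler0n. Qed.

Definition threshold_game : players R n m :=
  Players game_value_ge0 game_value_monotone game_value_subadditive
    game_budget_ge0.

(** For [i != i0] a single item is worth the whole budget [x i], so the minimum is the budget; if
    [x i = 0] it is 0 whatever the bundle. *)
Lemma liquid_welfare_threshold_game (Y : {ffun 'I_m -> 'I_n}) :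
  (forall i, i != i0 -> 0 < x i -> 0 < #|bundle Y i|)%N ->
  liquid_welfare threshold_game Y =
    (#|bundle Y i0| + \sum_(i < n | i != i0) x i)%N%:R.
Proof.
move=> Ypos; rewrite /liquid_welfare (bigD1 i0) //= natrD natr_sum.
congr (_ + _).
  rewrite /game_value /game_budget eqxx; apply: min_l.
  by rewrite ler_nat -[leqRHS]card_ord max_card.
apply: eq_bigr => i i_i0; rewrite /game_value /game_budget (negbTE i_i0).
apply: min_r; rewrite ler_nat /threshold_value.
case: (posnP (x i)) => [->//|x_gt0].
by rewrite (Ypos i i_i0 x_gt0); lia.
Qed.

End Game.

Section TiedBids.
Variables (R : realType) (n m : nat) (A : simple_auction R n m).

Definition tied_bids (i : 'I_n) (j : 'I_m) : R := 1.

Let X := bundle (outcome A tied_bids).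

Variables (i : 'I_n) (y : 'I_m -> R).
Hypotheses (n_gt1 : (1 < n)%N) (y_ge0 : forall j, 0 <= y j).

Let b' := [eta tied_bids with i |-> y].
Let W := bundle (outcome A b') i.

(** As [1 < n], some other player still bids 1 on [j]. *)
Lemma deviation_won_ge1 j : j \in W -> 1 <= y j.
Proof.
rewrite !inE ffunE => /eqP wj.
have [k ki] : exists k : 'I_n, k != i.
  have : (0 < #|predC1 i|)%N by rewrite cardC1 card_ord; lia.
  by case/card_gt0P => k; exists k.
have b'_ge0 l : 0 <= b' l j by rewrite /b' /=; case: ifP.
have := @winner_max _ _ _ A j (b'^~ j) b'_ge0 k.
by rewrite wj /b' /= (negbTE ki) eqxx.
Qed.

Lemma tied_deviation j : y j = 1 -> b'^~ j = tied_bids^~ j.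
Proof. by move=> yj; apply/funext => k; rewrite /b' /=; case: ifP. Qed.

(* Items tied in [tied_bids] can only be gained by bidding more than 1. *)
Lemma cheap_deviation : \sum_(j in W) y j <= #|W|%:R ->
  W \subset X i /\
  total_payment A b' i = \sum_(j in W) payment A j (tied_bids^~ j).
Proof.
move=> yW.
(* The won bids are each at least 1 and average at most 1, so all equal 1: on [W] the bids, hence
   winners and payments, are unchanged. *)
have y1 j : j \in W -> y j = 1.
  move=> jW; apply/eqP; rewrite eq_le deviation_won_ge1 // andbT.
  have : \sum_(k in W | k != j) (1 : R) <= \sum_(k in W | k != j) y k.
    by apply: ler_sum => k /andP[kW _]; exact: deviation_won_ge1.
  move: yW; rewrite -sum1_card natr_sum (bigD1 j) //= [leRHS](bigD1 j) //=.
  lra.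
split; last by apply: eq_bigr => j jW; rewrite tied_deviation // y1.
apply/fintype.subsetP => j jW; move: (jW).
by rewrite !inE !ffunE tied_deviation // y1.
Qed.

End TiedBids.

Lemma tied_bids_equilibrium (R : realType) (n m : nat)
    (A : simple_auction R n m) (i0 : 'I_n) : (1 < n)%N ->
  equilibrium A
    (threshold_game R n m
       (fun i => #|bundle (outcome A (tied_bids R n m)) i|) i0)
    (tied_bids R n m).
Proof.
move=> n_gt1; set b := tied_bids R n m; set X := bundle _.
set G := threshold_game _ _ _ _ _.
have b_ge0 j : forall k, 0 <= b^~ j k by move=> k; exact: ler01.
have value_ge i : #|X i|%:R <= valuation G i (X i).
  rewrite ler_nat; case: ifP => // _.
  by rewrite /threshold_value leqnn; nia.
have budget_ge i : #|X i|%:R <= budget G i.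
  rewrite ler_nat; case: ifP => // _.
  by rewrite -[leqRHS]card_ord max_card.
have pay_le1 j : payment A j (b^~ j) <= 1 by exact: payment_le_bid.
have pay_le (S : {set 'I_m}) : \sum_(j in S) payment A j (b^~ j) <= #|S|%:R.
  by rewrite -sum1_card natr_sum; apply: ler_sum.
split.
- by move=> i j; exact: ler01.
- move=> i; rewrite /conservative -/(X i) sumr_const le_min.
  by rewrite value_ge ?budget_ge.
move=> i y y_ge0; rewrite /conservative /utility.
set b' := [eta b with i |-> y]; set W := bundle (outcome A b') i.
rewrite /b' /= eqxx -/b' le_min => /andP[yv yc].
rewrite [X in (_ <= X)%E]ifT; last by rewrite (le_trans (pay_le _)) ?budget_ge.
case: ifP => [_|_]; last exact: leNye.
rewrite lee_fin {2}/total_payment -/(X i).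
have cheap := @cheap_deviation R n m A i y n_gt1 y_ge0.
have pos_pay : 0 <= total_payment A b' i.
  apply: sumr_ge0 => j _; apply: payment_ge0 => k.
  by rewrite /b' /=; case: ifP => // _; exact: ler01.
rewrite -/b -/b' -/W -/(X i) in cheap.
move: yv yc; rewrite /= /game_value /game_budget; case: ifP => [_ yv _|_ _ yc].
  (* Player [i0] can only drop items, each worth 1 to her and costing at most 1. *)
  have [WX ->] := cheap yv.
  rewrite -!sum1_card !natr_sum -!sumrB [leRHS](big_setID W) /=.
  by rewrite (finset.setIidPr WX) lerDl sumr_ge0 // => j _; rewrite subr_ge0.
have [Wlt|Wge] := ltnP #|W| #|X i|.
  have vW : (threshold_value #|X i| W <= #|X i|)%N.
    by rewrite /threshold_value [(#|X i| <= #|W|)%N]leqNgt Wlt addn0; nia.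
  have vX : (#|X i| + #|X i| <= threshold_value #|X i| (X i))%N.
    by rewrite /threshold_value leqnn; nia.
  have := pay_le (X i); move: vW vX.
  by rewrite -(ler_nat R) -[in X in _ -> X](ler_nat R) natrD; lra.
(* The budget [#|X i|] now bounds the bids by [#|W|], so [W] lies in [X i]; being no smaller, it
   equals [X i], at the same payments. *)
have Wge' : #|X i|%:R <= #|W|%:R :> R by rewrite ler_nat.
have [WX ->] := cheap (le_trans yc Wge').
have -> // : W = X i.
by apply/eqP; rewrite eqEcard WX.
Qed.

(** The outcome does not depend on the bids, and bidding 0 brings the payment down to 0. *)
Lemma single_player_equilibrium (R : realType) (m : nat)
    (A : simple_auction R 1 m) (G : players R 1 m) :
  equilibrium A G (fun _ _ => 0).
Proof.
have only (b : 'I_1 -> 'I_m -> R) : outcome A b = [ffun=> ord0].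
  by apply/ffunP => j; rewrite ffunE [LHS]ord1 ffunE.
have pay0 i : total_payment A (fun _ _ => 0) i = 0.
  apply: big1 => j _; apply/eqP; rewrite eq_le payment_ge0 // andbT.
  exact: (@payment_le_bid _ _ _ A j).
split=> // [i|i y y_ge0 _].
  by rewrite /conservative big1 // le_min valuation_ge0 budget_ge0.
rewrite /utility pay0 budget_ge0 !only; case: ifP => [_|_]; last exact: leNye.
rewrite lee_fin lerD2l lerN2; apply: sumr_ge0 => j _.
by apply: payment_ge0 => k; rewrite /=; case: ifP.
Qed.

Lemma optimal_liquid_welfare_ge (R : realType) (n m : nat)
    (G : players R n m) (Y : {ffun 'I_m -> 'I_n}) :
  liquid_welfare G Y <= optimal_liquid_welfare G.
Proof. exact: le_bigmax. Qed.

(** The worst equilibrium welfare lies between 0 and that of [b], and inversion in [\bar R] is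
    decreasing there, even if the infimum is 0. *)
Lemma LPoA_ge (R : realType) (n m : nat) (A : simple_auction R n m)
    (G : players R n m) (b : 'I_n -> 'I_m -> R) (r : R) :
  equilibrium A G b -> 0 < liquid_welfare G (outcome A b) ->
  r * liquid_welfare G (outcome A b) <= optimal_liquid_welfare G ->
  (r%:E <= LPoA A)%E.
Proof.
move=> eqb w_gt0 rw; set w := liquid_welfare G _ in w_gt0 rw.
apply: (@le_trans _ _ ((optimal_liquid_welfare G)%:E / w%:E)%E).
  by rewrite inver gt_eqF // lee_pdivlMr // -EFinM lee_fin.
apply: (@le_trans _ _
    ((optimal_liquid_welfare G)%:E / worst_equilibrium_liquid_welfare A G)%E);
  last first.
  by apply: ereal_sup_ubound; exists G => //; exists b.
have opt_ge0 : 0 <= optimal_liquid_welfare G.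
  exact: le_trans (ltW w_gt0) (optimal_liquid_welfare_ge _ _ _ _ _).
have worst_le : (worst_equilibrium_liquid_welfare A G <= w%:E)%E.
  by apply: ereal_inf_lbound; exists b.
have worst_ge0 : (0 <= worst_equilibrium_liquid_welfare A G)%E.
  apply: le_ereal_inf_tmp => _ [c _ <-]; rewrite lee_fin; apply: sumr_ge0 => i _.
  by rewrite le_min valuation_ge0 budget_ge0.
apply: lee_wpmul2l; first by rewrite lee_fin.
by rewrite lee_pV2 // inE lee_fin ltW.
Qed.

Section Optimum.
Variables (n m : nat) (i0 : 'I_n) (nm : (n <= m)%N).

Definition one_item_each : {ffun 'I_m -> 'I_n} := 
  [ffun j : 'I_m => odflt i0 (insub (j : nat))].

Lemma bundle_one_item_each i : i != i0 ->
  bundle one_item_each i = [set widen_ord nm i]%SET.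
Proof.
move=> ii0; apply/setP => j; rewrite !inE ffunE.
case: insubP => [k _ kj|jn] /=.
  by rewrite -!val_eqE /= kj.
rewrite eq_sym (negbTE ii0); apply/esym/negbTE; apply: contra jn => /eqP ->.
exact: (ltn_ord i).
Qed.

Lemma card_bundle_one_item_each : (#|bundle one_item_each i0| + n.-1 = m)%N.
Proof.
rewrite -[RHS](sum_card_bundle _ _ one_item_each) (bigD1 i0) //=; congr addn.
rewrite (eq_bigr (fun=> 1%N)) => [|i /bundle_one_item_each ->]; last first.
  exact: cards1.
by rewrite sum1_card cardC1 card_ord.
Qed.

End Optimum.

Theorem theorem6 (R : realType) (n m : nat) (hn : (0 < n)%N) (hm : (0 < m)%N)
    (A : simple_auction R n m) :
  ((2 - (n%:R - 1) / m%:R - 1 / n%:R : R)%:E <= LPoA A)%E.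
Proof.
pose b := tied_bids R n m.
pose x i := #|bundle (outcome A b) i|.
pose i0 := [arg min_(i < Ordinal hn) x i].
have x_min i : (x i0 <= x i)%N by rewrite /i0; case: arg_minnP => // k _; apply.
have sum_x : (x i0 + \sum_(i < n | i != i0) x i = m)%N.
  by rewrite -[RHS](sum_card_bundle _ _ (outcome A b)) [RHS](bigD1 i0).
have x_avg : (n * x i0 <= m)%N.
  rewrite -[leqRHS](sum_card_bundle _ _ (outcome A b)).
  rewrite -[n in (n * _)%N]card_ord -sum_nat_const.
  by apply: leq_sum => i _; exact: x_min.
pose G := threshold_game R n m x i0.
have LWb : liquid_welfare G (outcome A b) = m%:R.
  by rewrite liquid_welfare_threshold_game // sum_x.
(* For [n = 1] the tied bids are replaced by 0; the outcome, hence the welfare [m], stays the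
   same. *)
have [b' eqb' outb'] :
    exists2 b', equilibrium A G b' & outcome A b' = outcome A b.
  have [n_gt1|n_le1] := ltnP 1 n.
    by exists b => //; exact: tied_bids_equilibrium.
  have n1 : n = 1%N by lia.
  move: (A) (G) (b); rewrite n1 => A1 G1 b1.
  exists (fun _ _ => 0); first exact: single_player_equilibrium.
  by apply/ffunP => j; rewrite [LHS]ord1 [RHS]ord1.
have m_gt0 : 0 < m%:R :> R by rewrite ltr0n.
have n_gt0 : 0 < n%:R :> R by rewrite ltr0n.
apply: (LPoA_ge _ _ _ _ _ _ _ eqb'); rewrite outb' LWb //.
have -> : (2 - (n%:R - 1) / m%:R - 1 / n%:R) * m%:R =
          m%:R *+ 2 - (n%:R - 1) - m%:R / n%:R :> R.
  by field; rewrite !gt_eqF.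
(* If [m < n], then [n - 1 >= m] makes the target at most [m], which the equilibrium outcome itself
   attains. *)
have [nm|mn] := leqP n m; last first.
  apply: le_trans (optimal_liquid_welfare_ge _ _ _ G (outcome A b)).
  rewrite LWb; have : m%:R + 1 <= n%:R :> R by rewrite natr1 ler_nat.
  have : 0 <= m%:R / n%:R :> R by rewrite divr_ge0 ?ler0n.
  lra.
apply: le_trans (optimal_liquid_welfare_ge _ _ _ G (one_item_each n m i0)).
rewrite liquid_welfare_threshold_game => [|i ii0 _]; last first.
  by rewrite bundle_one_item_each // cards1.
have x_le : (x i0)%:R <= m%:R / n%:R :> R.
  by rewrite ler_pdivlMr // -natrM mulnC ler_nat.
(* The welfare is [(m - n + 1) + (m - x i0)], stated additively to avoid truncated subtraction. *)
have opt : ((#|bundle (one_item_each n m i0) i0| + \sum_(i < n | i != i0) x i)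
            + n + x i0 = m + m + 1)%N.
  by have := card_bundle_one_item_each n m i0 nm; lia.
move/(congr1 (fun k => k%:R : R)): opt; rewrite !(natrD _ _ (x i0)) !(natrD _ _ n).
rewrite [in RHS]natrD [in RHS]natrD; lra.
Qed.
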